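(* Let $\mathbb{X}$ be a compact metric space and let $f:\mathbb{X}\to\mathbb{X}$ be a continuous open map. Suppose there exists $\delta>0$ such that for every nonempty open set $U\subset\mathbb{X}$ the set $\overline{\bigcup_{n\ge 0}f^n(U)}$ contains some open ball of radius $\delta$. Then there exists a finite collection of topological attractors $A_1,\dots,A_\ell$ of $f$ such that: (1) $\beta_f(A_1)\cup\cdots\cup\beta_f(A_\ell)$ contains an open and dense subset of $\mathbb{X}$. (2) Each $A_j$ contains an open ball of radius $\delta$, and $A_j=\overline{\operatorname{interior}(A_j)}$. (3) Each $A_j$ is transitive, and $\omega_f(x)=A_j$ for generic $x\in\beta_f(A_j)$. (4) $\overline{\Omega(f)\setminus\bigcup_{j=1}^{\ell}A_j}$ is a compact set with empty interior, where $\Omega(f)$ is the non-wandering set of $f$. Furthermore, if for every nonempty open set $U\subset\mathbb{X}$ the set $\bigcup_{n\ge 0}f^n(U)$ itself (without closure) contains some open ball of radius $\delta$, then for each $j$ there is a set $\mathcal{A}_j\subset A_j$ such that: (5) $\mathcal{A}_j$ contains an open and dense subset of $A_j$, $f(\mathcal{A}_j)=\mathcal{A}_j$, and $f|_{\mathcal{A}_j}$ is strongly transitive. (6) Either $\omega_f(x)=A_j$ for every $x\in\mathcal{A}_j$, or $A_j$ has sensitive dependence on initial conditions.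
   Context: $\omega_f(x)$ denotes the $\omega$-limit set of $x$ under $f$. For a compact set $A\subset\mathbb{X}$ with $f(A)=A$, the basin of attraction is $\beta_f(A)=\{x\in\mathbb{X}: \omega_f(x)\subset A\}$. A compact set $A$ with $f(A)=A$ is called a topological attractor if $\beta_f(A)$ is not meager and, for every compact set $A'\subsetneq A$ with $f(A')=A'$, the set $\beta_f(A)\setminus\beta_f(A')$ is not meager. A set $A$ with $f(A)=A$ is transitive if for all nonempty relatively open $U,V\subset A$ there is $n\ge 1$ with $f^n(U)\cap V\ne\varnothing$. ''For generic $x\in\beta_f(A_j)$'' means for all $x$ in a residual subset of $\beta_f(A_j)$. A map $g:X\to X$ is strongly transitive on $X$ if $\bigcup_{n\ge 0}g^n(V)=X$ for every nonempty (relatively) open set $V\subset X$. A set $\Lambda\subset\mathbb{X}$ has sensitive dependence on initial conditions if there exists $r>0$ such that $\sup_{n}\operatorname{diameter}(f^n(\Lambda\cap B_\varepsilon(x)))\ge r$ for every $x\in\Lambda$ and every $\varepsilon>0$, where $B_\varepsilon(x)$ is the open ball of radius $\varepsilon$ about $x$.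
   Formalization: In (3), ''generic x in the basin of A_j'' is taken to mean that the exceptional points of the basin form a meager subset of the whole space X; with residuality in the subspace topology of the basin the claim is false. *)

(* Defs.v *)
From mathcomp Require Import all_boot all_order all_algebra.
From mathcomp Require Import all_classical all_reals all_analysis.

Set Implicit Arguments.
Unset Strict Implicit.
Unset Printing Implicit Defensive.

Import Order.TTheory GRing.Theory Num.Theory.

Local Open Scope classical_set_scope.
Local Open Scope ring_scope.

Definition open_map (X Y : topologicalType) (f : X -> Y) : Prop :=
  forall U : set X, open U -> open (f @` U).

Definition relatively_open (X : topologicalType) (A U : set X) : Prop :=
  exists2 O : set X, open O & U = A `&` O.

Definition nowhere_dense (X : topologicalType) (A : set X) : Prop :=
  interior (closure A) = set0.

Definition meager (X : topologicalType) (A : set X) : Prop :=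
  exists2 F : nat -> set X,
    (forall n, nowhere_dense (F n)) & A = \bigcup_n F n.

(* [G] is residual in [B]: the exceptional set is meager in the ambient space
   [X], the same notion of meagerness as in [topological_attractor]; it is not
   meagerness in the subspace topology of [B]. *)
Definition residual_in (X : topologicalType) (B G : set X) : Prop :=
  G `<=` B /\ meager (B `\` G).

Definition forward_orbit (X : Type) (f : X -> X) (U : set X) : set X :=
  \bigcup_n (iter n f @` U).

Definition omega_limit (X : topologicalType) (f : X -> X) (x : X) : set X :=
  cluster ((fun n => iter n f x) @ \oo).

Definition basin (X : topologicalType) (f : X -> X) (A : set X) : set X :=
  [set x | omega_limit f x `<=` A].

Definition topological_attractor (X : topologicalType) (f : X -> X)
    (A : set X) : Prop :=
  [/\ compact A,
      f @` A = A,
      ~ meager (basin f A) &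
      forall A' : set X, compact A' -> f @` A' = A' -> A' `<` A ->
        ~ meager (basin f A `\` basin f A')].

Definition transitive_on (X : topologicalType) (f : X -> X) (A : set X)
    : Prop :=
  f @` A = A /\
  forall U V : set X,
    relatively_open A U -> relatively_open A V -> U !=set0 -> V !=set0 ->
    exists2 n : nat, (1 <= n)%N & (iter n f @` U) `&` V !=set0.

(* The restriction of [f] to [A], assumed to be a self-map of [A]; its iterates
   are those of [f]. *)
Definition strongly_transitive_on (X : topologicalType) (f : X -> X)
    (A : set X) : Prop :=
  forall V : set X, relatively_open A V -> V !=set0 -> forward_orbit f V = A.

Definition nonwandering (X : topologicalType) (f : X -> X) : set X :=
  [set x | forall U : set X, open U -> U x ->
     exists2 n : nat, (1 <= n)%N & (iter n f @` U) `&` U !=set0].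

Definition contains_ball (R : realType) (X : metricType R) (d : R)
    (A : set X) : Prop :=
  exists x : X, ball x d `<=` A.

(* [-oo] on the empty set. *)
Definition diameter (R : realType) (X : metricType R) (A : set X) : \bar R :=
  ereal_sup [set (mdist p.1 p.2)%:E | p in A `*` A].

Definition sensitive_dependence (R : realType) (X : metricType R)
    (f : X -> X) (L : set X) : Prop :=
  exists2 r : R, 0 < r &
    forall (x : X) (e : R), L x -> 0 < e ->
      (r%:E <= ereal_sup
         [set diameter (iter n f @` (L `&` ball x e)) | n in [set: nat]])%E.

(* Main.v *)
(** Call a closed forward-invariant set with nonempty interior trapping. By the
    hypothesis every trapping set contains a ball of radius [d], so compactness
    of the space of centres keeps a [d]-ball in the intersection of a chain of
    trapping sets, and Zorn's lemma yields minimal trapping sets below every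
    trapping set. The orbit of any nonempty open subset of a minimal trapping
    set is dense in it; minimal trapping sets have pairwise disjoint interiors,
    each containing a [d]-ball, so they are finitely many: these are the
    attractors. Almost every orbit (in the sense of Baire) enters the interior
    of one of them and is then dense in it.

    When orbits of open sets contain [d]-balls without taking closures, the
    orbits of the nonempty open subsets of an attractor form a directed family,
    so the same compactness argument gives their intersection (the strong core)
    a [d]-ball; it is open, dense, and strongly transitive. A point of the core
    whose omega-limit set misses a point [y] of the attractor has preimages near
    every point, next to points whose orbits come close to [y] arbitrarily
    late. *)

From HB Require Import structures.
Require Import Defs.
From mathcomp Require Import all_boot all_order all_algebra.
From mathcomp Require Import all_classical all_reals all_analysis.

Set Implicit Arguments.
Unset Strict Implicit.
Unset Printing Implicit Defensive.

Import Order.TTheory GRing.Theory Num.Theory.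

Local Open Scope classical_set_scope.
Local Open Scope ring_scope.

(** * Nowhere dense and meager sets *)

Section Topology.
Variable X : topologicalType.
Implicit Types A B U V W : set X.

Lemma open_meets_closure A U x : open U -> U x -> closure A x -> A `&` U !=set0.
Proof. by move=> oU Ux; apply; exact: open_nbhs_nbhs. Qed.

Lemma closure_sub_closed A B : closed B -> A `<=` B -> closure A `<=` B.
Proof. by move=> cB AB x /(closureS AB)/cB. Qed.

Lemma open_sub_interior A U : open U -> U `<=` A -> U `<=` A°.
Proof. by move=> oU; rewrite (open_subsetE _ oU). Qed.

Lemma nowhere_denseP A :
  (forall U, open U -> U !=set0 -> exists2 V, open V & V `<=` U /\
     V !=set0 /\ V `&` A = set0) -> nowhere_dense A.
Proof.
move=> H; apply/nonemptyPn => -[x Ax].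
have [V oV [VU [[y Vy] VA]]] := H _ (@open_interior _ _) (ex_intro _ x Ax).
have [z [Az Vz]] := open_meets_closure oV Vy (interior_subset (VU _ Vy)).
by have : (V `&` A) z by []; rewrite VA.
Qed.

Lemma nowhere_dense_sub (A B : set X) :
  A `<=` B -> nowhere_dense B -> nowhere_dense A.
Proof.
by rewrite /nowhere_dense => /closureS/interiorS + B0; rewrite B0 subset0.
Qed.

Lemma nowhere_dense_dense_open W : open W -> dense W -> nowhere_dense (~` W).
Proof.
move=> oW dW; apply: nowhere_denseP => U oU U0; exists (U `&` W).
  exact: openI.
split; first by move=> ? [].
by split; [exact: dW | rewrite -setIA setICr setI0].
Qed.

Lemma meager_sub A B : A `<=` B -> meager B -> meager A.
Proof.
move=> AB [F Fnd BE]; exists (fun n => F n `&` A).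
  by move=> n; apply: nowhere_dense_sub (Fnd n) => ? [].
by rewrite -setI_bigcupl -BE; apply/esym/setIidPr.
Qed.

Lemma meagerU A B : meager A -> meager B -> meager (A `|` B).
Proof.
move=> [F Fnd ->] [G Gnd ->].
exists (fun n => if odd n then F n./2 else G n./2).
  by move=> n; case: ifP.
apply/seteqP; split=> x.
  by case=> -[n _ ?]; [exists n.*2.+1 | exists n.*2]; rewrite //= ?odd_double /=
     ?uphalf_double ?doubleK.
by case=> n _; case: ifP => _ ?; [left | right]; exists n./2.
Qed.

Lemma meager_bigcup_countable (I : Type) (D : set I) (F : I -> set X) :
  countable D -> (forall i, D i -> nowhere_dense (F i)) ->
  meager (\bigcup_(i in D) F i).
Proof.
move=> /pfcard_geP[->|[g]] Fnd.
  exists (fun=> set0); last by rewrite bigcup_set0 bigcup0.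
  by move=> n; rewrite /nowhere_dense closure0 interior0.
exists (F \o g) => [n|]; first exact/Fnd/funS.
apply/seteqP; split=> x [].
  by move=> i Di Fx; have [n _ gn] := @surj _ _ _ _ g _ Di; exists n => //=; rewrite gn.
by move=> n _ ?; exists (g n) => //; exact: funS.
Qed.

Lemma nowhere_dense_meager A : nowhere_dense A -> meager A.
Proof.
by move=> And; exists (fun=> A) => //; rewrite bigcup_const //; exists 0%N.
Qed.

End Topology.

(** * The Baire category theorem in compact uniform spaces *)

Section Baire.
Variable X : uniformType.
Hypothesis cptX : compact [set: X].

Let shrink (F U : set X) : nowhere_dense F -> open U -> U !=set0 ->
  exists V, [/\ open V, V !=set0 & closure V `<=` U `\` F].
Proof.
move=> Fnd oU [x Ux].
have [y [Uy ncFy]] : exists y, U y /\ ~ closure F y.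
  apply: contrapT => /forallNP UF.
  have : (closure F)° x.
    by apply: (open_sub_interior oU) Ux => y Uy; apply: contrapT => ncFy; case: (UF y).
  by rewrite Fnd.
have oUF : open (U `&` ~` closure F).
  by apply: openI => //; exact/closed_openC/closed_closure.
have [V nV cV] := @uniform_regular X y _ (open_nbhs_nbhs (conj oUF (conj Uy ncFy))).
exists V°; split; first exact: open_interior.
- by exists y.
- move=> z /(closureS (@interior_subset _ _))/cV[Uz ncFz].
  by split => // /subset_closure.
Qed.

(** If the [F n] covered [U], repeated shrinking would give open sets [V n] with the closure of
    [V n.+1] inside [V n] and off [F n]. By compactness a point lies in all these closures, hence in
    [U] and in no [F n]. *)
Lemma compact_baire (U : set X) : open U -> U !=set0 -> ~ meager U.
Proof.
move=> oU U0 [F Fnd UE].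
pose T := {V : set X | open V /\ V !=set0}.
(* The state carries the index of the set to be avoided next, so that dependent choice treats every
   [F n] in turn. *)
have step (p : nat * T) : {q : nat * T | q.1 = p.1.+1 /\
    closure (sval q.2) `<=` sval p.2 `\` F p.1}.
  case: p => n [V [oV V0]]; apply: cid.
  have [W [oW W0 WV]] := shrink (Fnd n) oV V0.
  by exists (n.+1, exist _ W (conj oW W0)).
have [g [g0 gS]] := dependent_choice step (0%N, exist _ U (conj oU U0)).
have gn n : (g n).1 = n by elim: n => [|n IH]; [rewrite g0|rewrite (gS n).1 IH].
pose V n := sval (g n).2.
have VS n : closure (V n.+1) `<=` V n `\` F n.
  by rewrite -[in F n](gn n); exact: (gS n).2.
have Vmono m n : (m <= n)%N -> V n `<=` V m.
  elim: n => [|n IH]; first by rewrite leqn0 => /eqP ->.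
  rewrite leq_eqVlt => /predU1P[-> //|/IH mn].
  by move=> x /subset_closure/VS[/mn].
have FV : Filter (filter_from [set: nat] V).
  apply: filter_fromT_filter; first by exists 0%N.
  move=> i j; exists (maxn i j) => x Vx.
  by split; apply: (Vmono _ _ _ _ Vx); rewrite ?leq_maxl ?leq_maxr.
have PFV : ProperFilter (filter_from [set: nat] V).
  by apply: filter_from_proper => n _; exact: (proj2 (svalP (g n).2)).
have [x [_ xV]] := cptX PFV filterT.
have xcl n : closure (V n) x.
  by move=> B nB; apply: xV => //; exists n.
have Ux : U x by have [] := VS 0%N _ (xcl 1%N); rewrite /V g0.
by move: Ux; rewrite UE => -[n _ Fx]; have [_] := VS n _ (xcl n.+1).
Qed.

End Baire.

(** * Compactness: countable bases, finite nets, balls in directed intersections *)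

Section CompactMetric.
Variables (R : realType) (X : metricType R).
Hypothesis cptX : compact [set: X].

Lemma compact_metric_second_countable : @second_countable X.
Proof.
have [[x0 _]|/nonemptyPn X0] := pselect ([set: X] !=set0); last first.
  exists set0; first exact: countable0.
  by split=> // x; have : [set: X] x by []; rewrite X0.
pose P : pseudoPMetricType R := HB.pack X (isPointed.Build X x0).
exact: (@compact_second_countable R P cptX).
Qed.

Lemma compact_metric_net (d : R) : 0 < d ->
  exists s : seq X, forall x, exists2 y, y \in s & ball y d x.
Proof.
move=> d0; have [[x0 _]|/nonemptyPn X0] := pselect ([set: X] !=set0); last first.
  by exists [::] => x; have : [set: X] x by []; rewrite X0.
pose P : pseudoPMetricType R := HB.pack X (isPointed.Build X x0).
have /(_ X setT (fun x => (ball x d)°)) [] : @cover_compact P setT.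
- by rewrite -compact_cover.
- by move=> x _; exact: open_interior.
- by move=> x _; exists x => //; exact: nbhsx_ballx.
move=> D _; have /finite_seqP[s ->] := finite_fset D => cov.
by exists s => x; have [//|y sy /interior_subset yx] := cov x; exists y.
Qed.

Lemma open_metric_ball (x : X) (d : R) : open (ball x d).
Proof.
rewrite openE => y; rewrite ballEmdist /= => xy.
apply/nbhs_ballP; exists (d - mdist x y); first by rewrite /= subr_gt0.
move=> z; rewrite ballEmdist /= ltrBrDl.
exact/le_lt_trans/metric_triangle.
Qed.

(* A cluster point of the centres is the centre of the required ball. *)
Lemma contains_ball_bigcap (d : R) (S : set (set X)) : 0 < d -> S !=set0 ->
  (forall A B, S A -> S B -> exists2 C, S C & C `<=` A `&` B) ->
  (forall A, S A -> contains_ball d A) ->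
  contains_ball d (\bigcap_(A in S) A).
Proof.
move=> d0 [A0 SA0] dirS ballS.
pose E A := [set x : X | ball x d `<=` A].
have FE : Filter (filter_from S E).
  apply: filter_from_filter; first by exists A0.
  move=> A B SA SB; have [C SC CAB] := dirS _ _ SA SB.
  by exists C => // x Cx; split=> y /Cx/CAB[].
have PFE : ProperFilter (filter_from S E).
  by apply: filter_from_proper => A /ballS.
have [x [_ xE]] := cptX PFE filterT.
exists x => y xy A SA.
have [//||z [zA yz]] := xE (E A) (ball y d); first by exists A.
  apply: open_nbhs_nbhs; split; first exact: open_metric_ball.
  exact: ball_sym.
exact/zA/ball_sym.
Qed.

End CompactMetric.

(** * Forward orbits and omega-limit sets of continuous and open maps *)

Section Orbits.
Variables (X : topologicalType) (f : X -> X).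
Implicit Types A B K U V W : set X.

Definition forward_invariant A := f @` A `<=` A.

Lemma iter_invariant A n x : forward_invariant A -> A x -> A (iter n f x).
Proof. by move=> fA Ax; elim: n => //= n IH; apply: fA; exists (iter n f x). Qed.

Lemma sub_forward_orbit U : U `<=` forward_orbit f U.
Proof. by move=> x Ux; exists 0%N => //; exists x. Qed.

Lemma forward_orbit_invariant U : forward_invariant (forward_orbit f U).
Proof. by move=> _ [_ [n _ [x Ux <-]] <-]; exists n.+1 => //; exists x. Qed.

Lemma forward_orbit_subset A U :
  forward_invariant A -> U `<=` A -> forward_orbit f U `<=` A.
Proof. by move=> fA UA _ [n _ [x /UA Ax <-]]; exact: iter_invariant. Qed.

Lemma omega_limitP x y : omega_limit f x y <->
  forall V, nbhs y V -> forall m, exists2 n, (m <= n)%N & V (iter n f x).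
Proof.
split=> [xy V yV m|H S V [m _ mS] yV].
  have [|z [[n /= mn <-] Vz]] := xy [set iter n f x | n in [set n | (m <= n)%N]] V _ yV.
    by exists m => // n /= mn; exists n.
  by exists n.
by have [n mn Vn] := H V yV m; exists (iter n f x); split=> //; exact: mS.
Qed.

Lemma omega_limit_sub A x n : closed A -> forward_invariant A ->
  A (iter n f x) -> omega_limit f x `<=` A.
Proof.
move=> cA fA Ax y /omega_limitP xy; apply: cA => V /xy/(_ n)[m nm Vm].
exists (iter m f x); split=> //.
by rewrite -(subnK nm) iterD; exact: iter_invariant.
Qed.

Hypothesis contf : continuous f.

Lemma continuous_iter n : continuous (iter n f).
Proof.
elim: n => [|n IH] x; first exact: cvg_id.
by apply: (@continuous_comp _ _ _ (iter n f) f); [exact: IH | exact: contf].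
Qed.

Lemma open_preimage_iter n V : open V -> open (iter n f @^-1` V).
Proof. by move/continuousP: (@continuous_iter n); apply. Qed.

Lemma closure_invariant A : forward_invariant A -> forward_invariant (closure A).
Proof.
move=> fA _ [x Ax <-] V /contf/Ax[y [Ay Vy]].
by exists (f y); split=> //; apply: fA; exists y.
Qed.

Hypothesis openf : open_map f.

Lemma open_image_iter n U : open U -> open (iter n f @` U).
Proof.
move=> oU; elim: n => [|n /openf]; first by rewrite (_ : iter 0 f = id) ?image_id.
by rewrite image_comp.
Qed.

Lemma open_forward_orbit U : open U -> open (forward_orbit f U).
Proof. by move=> oU; apply: bigcup_open => n _; exact: open_image_iter. Qed.

Lemma interior_invariant A : forward_invariant A -> forward_invariant A°.
Proof.
move=> fA; apply: open_sub_interior; first exact/openf/open_interior.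
by apply: subset_trans fA; apply: image_subset; exact: interior_subset.
Qed.

End Orbits.

(** * Trapping sets and the minimal ones among them *)

Definition trapping (X : topologicalType) (f : X -> X) (K : set X) :=
  [/\ closed K, forward_invariant f K & K° !=set0].

Definition minimal_trapping (X : topologicalType) (f : X -> X) (K : set X) :=
  trapping f K /\ forall L, trapping f L -> L `<=` K -> L = K.

Section Trapping.
Variables (X : topologicalType) (f : X -> X).
Hypotheses (contf : continuous f) (openf : open_map f).
Implicit Types K L M U V : set X.

Lemma trapping_closure_orbit U : open U -> U !=set0 ->
  trapping f (closure (forward_orbit f U)).
Proof.
move=> oU [x Ux]; split; first exact: closed_closure.
  exact/closure_invariant/forward_orbit_invariant.
exists x; apply: (open_sub_interior (open_forward_orbit openf oU)).
  exact: subset_closure.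
exact: sub_forward_orbit.
Qed.

Section Minimal.
Variable M : set X.
Hypothesis minM : minimal_trapping f M.

Lemma minimal_trapping_closed : closed M. Proof. by case: minM => -[]. Qed.

Lemma minimal_trapping_invariant : forward_invariant f M.
Proof. by case: minM => -[]. Qed.

Lemma minimal_trapping_interior : M° !=set0.
Proof. by case: minM => -[]. Qed.

(** The closed orbit of [U] is itself trapping and lies in [M], so minimality leaves no room between
    them. *)
Lemma minimal_trapping_orbit U : open U -> U !=set0 -> U `<=` M ->
  closure (forward_orbit f U) = M.
Proof.
move=> oU U0 UM; apply: minM.2; first exact: trapping_closure_orbit.
apply: closure_sub_closed; first exact: minimal_trapping_closed.
exact: forward_orbit_subset minimal_trapping_invariant UM.
Qed.

Lemma minimal_trapping_dense U : open U -> U !=set0 -> U `<=` M ->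
  forward_invariant f U -> closure U = M.
Proof.
move=> oU U0 UM fU; rewrite -(minimal_trapping_orbit oU U0 UM); congr closure.
apply/seteqP; split; first exact: sub_forward_orbit.
exact: forward_orbit_subset.
Qed.

(** Since [f] is open, the interior of [M] is again forward-invariant, and invariant nonempty open
    subsets of [M] are dense in it. *)
Lemma minimal_trapping_regular : closure M° = M.
Proof.
apply: minimal_trapping_dense; first exact: open_interior.
- exact: minimal_trapping_interior.
- exact: interior_subset.
exact/interior_invariant/minimal_trapping_invariant.
Qed.

Lemma minimal_trapping_meets_interior V x : open V -> V x -> M x ->
  (V `&` M°) !=set0.
Proof.
move=> oV Vx; rewrite -minimal_trapping_regular => /(open_meets_closure oV Vx).
by rewrite minimal_trapping_regular setIC.
Qed.

Lemma minimal_trapping_hits U V m : open U -> U !=set0 -> U `<=` M ->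
  open V -> V `&` M !=set0 -> exists x n, [/\ U x, (m <= n)%N & V (iter n f x)].
Proof.
move=> oU U0 UM oV [y [Vy My]].
have /minimal_trapping_orbit E := open_image_iter openf m oU.
have : closure (forward_orbit f (iter m f @` U)) y.
  rewrite E //; first exact: image_nonempty.
  by move=> _ [x /UM Mx <-]; exact: iter_invariant minimal_trapping_invariant Mx.
move=> /(open_meets_closure oV Vy)[_ [[n _ [_ [x Ux <-] <-]] Vx]].
by exists x, (n + m)%N; rewrite leq_addl iterD.
Qed.

Lemma minimal_trapping_omega x n : M (iter n f x) -> omega_limit f x `<=` M.
Proof.
apply: omega_limit_sub minimal_trapping_closed minimal_trapping_invariant.
Qed.

End Minimal.

(** Both sets are the closed orbit of the common part of their interiors. *)
Lemma minimal_trapping_eq M N : minimal_trapping f M -> minimal_trapping f N ->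
  M° `&` N° !=set0 -> M = N.
Proof.
move=> minM minN MN0.
have oMN : open (M° `&` N°) by apply: openI; exact: open_interior.
rewrite -(minimal_trapping_orbit minM oMN MN0).
  by apply: minimal_trapping_orbit => // x [_ /interior_subset].
by move=> x [/interior_subset].
Qed.

Lemma minimal_trapping_sub M N : minimal_trapping f M -> minimal_trapping f N ->
  M `<=` N -> M = N.
Proof. by move=> [tM _] [_ minN] MN; exact: minN. Qed.

Lemma minimal_trapping_transitive M : minimal_trapping f M -> f @` M = M ->
  transitive_on f M.
Proof.
move=> minM fM; split=> // U V [U' oU' ->] [P oP ->] [x [Mx Ux]] MP0.
(* A relatively open set need not be open in the space; cutting it down to the dense interior of [M]
   makes it so. The bound [1] excludes the trivial time [0]. *)
have [|||||z [n [[Uz Mz] n1 Pz]]] := @minimal_trapping_hits _ minM (U' `&` M°) P 1.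
- by apply: openI => //; exact: open_interior.
- exact: minimal_trapping_meets_interior Ux Mx.
- by move=> ? [_ /interior_subset].
- exact: oP.
- by rewrite setIC.
exists n => //; exists (iter n f z); have {}Mz := interior_subset Mz.
split; first by exists z.
by split=> //; exact: iter_invariant (minimal_trapping_invariant minM) Mz.
Qed.

(** The open dense set for claim (1): an orbit that enters the interior of a minimal set has its
    omega-limit set in that minimal set. *)
Definition entering_minimal : set X :=
  [set x | exists M n, minimal_trapping f M /\ M° (iter n f x)].

Lemma open_entering_minimal : open entering_minimal.
Proof.
rewrite openE => x [M [n [minM Mx]]].
have oM : open (iter n f @^-1` M°).
  exact/(open_preimage_iter contf)/open_interior.
by apply: filterS (open_nbhs_nbhs (conj oM Mx)) => y My; exists M, n.
Qed.

Lemma iter_fixed n x : iter n f x = x -> forall k, iter (k * n) f x = x.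
Proof. by move=> nx; elim=> // k IH; rewrite mulSn iterD IH. Qed.

End Trapping.

(** * Consequences of separation: invariance of minimal sets, late returns *)

Section Hausdorff.
Variables (X : topologicalType) (f : X -> X).
Hypotheses (contf : continuous f) (openf : open_map f).
Hypotheses (cptX : compact [set: X]) (hausX : hausdorff_space X).
Implicit Types M U V : set X.

(** The image of [M] is closed by compactness and contains the image of the interior of [M], an open
    invariant subset of [M], which is dense in [M]. *)
Lemma minimal_trapping_image M : minimal_trapping f M -> f @` M = M.
Proof.
move=> minM; apply/seteqP; split; first exact: minimal_trapping_invariant minM.
have [x Mx] := minimal_trapping_interior minM.
have fM : forward_invariant f M° := interior_invariant openf (minimal_trapping_invariant minM).
rewrite -[X in X `<=` _](@minimal_trapping_dense _ _ contf openf _ minM (f @` M°)).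
- apply: closure_sub_closed; last by apply: image_subset; exact: interior_subset.
  apply: compact_closed => //; apply: continuous_compact.
    exact: continuous_subspaceT.
  by apply: (subclosed_compact (minimal_trapping_closed minM) cptX).
- exact/openf/open_interior.
- by apply: image_nonempty; exists x.
- by move=> y /fM/interior_subset.
- by move=> _ [y /fM My <-]; exists y.
Qed.

(** A point that is not periodic has neighbourhoods with no return before time [N]. Induction on
    [N]: disjoint neighbourhoods of [x] and [iter N f x] rule out a return at time [N] itself. *)
Lemma late_return x U N : open U -> U x ->
  (forall n, (0 < n)%N -> iter n f x <> x) ->
  exists V, [/\ open V, V x, V `<=` U &
    forall n y, (0 < n < N)%N -> V y -> ~ V (iter n f y)].
Proof.
move=> oU Ux aper; elim: N => [|N [V [oV Vx VU Vret]]].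
  by exists U; split=> // n y; rewrite ltn0 andbF.
have [N0|N0] := posnP N.
  by exists V; split=> // n y; rewrite N0; case: n.
have [P [Q [oP Px oQ Qx PQ0]]] : exists P Q,
    [/\ open P, P x, open Q, Q (iter N f x) & P `&` Q = set0].
  move: hausX; rewrite open_hausdorff => /(_ x (iter N f x)).
  have /eqP xNx : x <> iter N f x by apply/nesym/aper.
  move=> /(_ xNx)[[P Q]]/= [/set_mem Px /set_mem Qx] [oP oQ /eqP PQ].
  by exists P, Q.
exists (V `&` (P `&` iter N f @^-1` Q)); split.
- by apply: openI => //; apply: openI => //; exact: open_preimage_iter.
- by [].
- by move=> y [/VU].
move=> n y /andP[n0]; rewrite ltnS leq_eqVlt => /predU1P[->|nN].
  move=> [_ [_ Qy]] [_ [Py _]].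
  by have : (P `&` Q) (iter N f y) by []; rewrite PQ0.
by move=> [Vy _] [Vny _]; apply: (Vret n y) => //; rewrite n0.
Qed.

End Hausdorff.

(** * Existence, finiteness and genericity of the attractors *)

Section Attractors.
Variables (R : realType) (X : metricType R) (f : X -> X) (d : R).
Hypotheses (cptX : compact [set: X]) (contf : continuous f).
Hypotheses (openf : open_map f) (d_gt0 : 0 < d).
Hypothesis orbit_ball : forall U : set X, open U -> U !=set0 ->
  contains_ball d (closure (forward_orbit f U)).
Implicit Types K L M U V : set X.

Let hausX : hausdorff_space X := @metric_hausdorff R X.

Lemma trapping_ball K : trapping f K -> contains_ball d K.
Proof.
move=> [cK fK K0]; have [x xK] := orbit_ball (@open_interior _ K) K0.
exists x; apply: subset_trans xK _; apply: closure_sub_closed => //.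
exact: forward_orbit_subset (@interior_subset _ _).
Qed.

Lemma minimal_trapping_exists K : trapping f K ->
  exists2 M, minimal_trapping f M & M `<=` K.
Proof.
(* Zorn's lemma for unions of chains is applied to the removed parts [C]: a maximal removed part
   leaves a minimal trapping set. *)
move=> tK; have [|C [tC maxC]] := @Zorn_bigcup X (fun C => trapping f (K `\` C)).
  move=> F tF totF.
  (* Adding [K] keeps the family nonempty when the chain [F] is empty. *)
  pose S := [set K] `|` [set K `\` C | C in F].
  have -> : K `\` \bigcup_(C in F) C = \bigcap_(A in S) A.
    apply/seteqP; split=> x.
      by move=> [Kx nFx] A [-> //|[C FC <-]]; split=> // Cx; apply: nFx; exists C.
    move=> Sx; split=> [|[C FC Cx]]; first by apply: Sx; left.
    by have [|] := Sx (K `\` C); [right; exists C | move=> _; apply].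
  have tS A : S A -> trapping f A by move=> [-> //|[C FC <-]]; exact: tF.
  split.
  - by apply: closed_bigI => A /tS[].
  - move=> _ [x Sx <-] A SA; have [_ + _] := tS _ SA; apply.
    by exists x => //; exact: Sx.
  - have [|||x xS] := @contains_ball_bigcap _ _ cptX d S d_gt0.
    + by exists K; left.
    + move=> A B [->|[C FC <-]] [->|[D FD <-]].
      * by exists K => [|//]; left.
      * by exists (K `\` D); [right; exists D | move=> x [Kx ?]].
      * by exists (K `\` C); [right; exists C | move=> x [Kx ?]].
      have [CD|DC] := totF _ _ FC FD.
        exists (K `\` D); first by right; exists D.
        by move=> x [Kx nDx]; split; split=> // /CD.
      exists (K `\` C); first by right; exists C.
      by move=> x [Kx nCx]; split; split=> // /DC.
    + by move=> A /tS/trapping_ball.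
    exists x; apply: (open_sub_interior (open_metric_ball x d) xS).
    exact: ballxx.
exists (K `\` C); last by move=> x [].
split=> // L tL LKC; apply: contrapT => LneK.
apply: (maxC (~` L)); last first.
  rewrite setDE setCK; suff -> : K `&` L = L by [].
  by apply/setIidPr => x /LKC[].
rewrite properEneq; split; last by move=> x Cx /LKC[_].
apply/eqP => CL; apply: LneK; rewrite CL setDE setCK.
by apply/esym/setIidPr => x /LKC[].
Qed.

(** The closed orbit of an open set contains a minimal set; the interior of the latter, being open,
    meets the orbit itself and not only its closure. *)
Lemma dense_entering_minimal : dense (entering_minimal f).
Proof.
move=> U U0 oU.
have [M minM MU] := minimal_trapping_exists (trapping_closure_orbit contf openf oU U0).
have [x Mx] := minimal_trapping_interior minM.
have [_ [[n _ [y Uy <-]] My]] :=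
  open_meets_closure (@open_interior _ M) Mx (MU _ (interior_subset Mx)).
by exists y; split=> //; exists M, n.
Qed.

(* Distinct minimal sets have disjoint interiors, and each of these interiors
   contains a point of a finite [d]-net. *)
Lemma minimal_trapping_finite : exists l (A : 'I_l -> set X),
  (forall j, minimal_trapping f (A j)) /\
  (forall M, minimal_trapping f M -> exists j, M = A j).
Proof.
have [s sP] := compact_metric_net cptX d_gt0.
pose Q y M := minimal_trapping f M /\ M° y.
pose t := [seq y <- s | `[< exists M, Q y M >]].
have tP (j : 'I_(size t)) : exists M, Q (tnth (in_tuple t) j) M.
  by have := mem_tnth j (in_tuple t); rewrite mem_filter => /andP[/asboolP].
exists (size t), (fun j => sval (cid (tP j))); split.
  by move=> j; case: cid => M [].
move=> M minM; have [x xM] := trapping_ball minM.1.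
have [y ys yx] := sP x.
have My : M° y.
  apply: (open_sub_interior (open_metric_ball x d) xM).
  exact: ball_sym.
have /tnthP[j yj] : y \in in_tuple t.
  by rewrite mem_filter ys andbT; apply/asboolP; exists M.
exists j; case: cid => N [minN]; rewrite -yj => Ny.
by apply: minimal_trapping_eq minM minN _ => //; exists y.
Qed.

Definition generic : set X :=
  [set x | exists2 M, minimal_trapping f M & omega_limit f x = M].

(** An exceptional point either never enters the interior of a minimal set, or enters that of some
    [M] and, from some time on, avoids a basic open set meeting [M]. The first kind form a nowhere
    dense set, the second a countable union of such sets. *)
Lemma meager_not_generic : meager (~` generic).
Proof.
have [B cB [oB basisB]] := compact_metric_second_countable cptX.
pose N (p : set X * nat) := [set x | (exists M n, [/\ minimal_trapping f M,
  p.1 `&` M !=set0 & M° (iter n f x)]) /\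
  forall n, (p.2 <= n)%N -> ~ p.1 (iter n f x)].
have Nnd p : (B `*` setT) p -> nowhere_dense (N p).
  case: p => V m [/= /oB oV _]; apply: nowhere_denseP => U oU [x0 Ux0].
  have [[x [[[M [n [minM VM Mx]]] _] Ux]]|/nonemptyPn NU] :=
    pselect (N (V, m) `&` U !=set0); last first.
    by exists U => //; split=> //; split; [exists x0 | rewrite setIC].
  (* The part of [U] that is inside [M] at time [n] has an open image there, some point of which
     reaches [V] after at least [m] more steps. Pulling [V] back to [U] gives an open set disjoint
     from [N (V, m)]. *)
  have oUM : open (iter n f @` (U `&` iter n f @^-1` M°)).
    apply: open_image_iter => //; apply: openI => //.
    exact/(open_preimage_iter contf)/open_interior.
  have [||||_ [k [[y [Uy My] <-] mk Vy]]] :=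
      @minimal_trapping_hits _ _ contf openf _ minM _ V m oUM.
  - by exists (iter n f x); exists x.
  - by move=> _ [y [_ /interior_subset ?] <-].
  - exact: oV.
  - exact: VM.
  exists (U `&` iter (k + n) f @^-1` V).
    by apply: openI => //; exact: open_preimage_iter.
  split; first by move=> ? [].
  split; first by exists y; split=> //=; rewrite iterD.
  rewrite -subset0 => z [[_ Vz] [_ Nz]].
  exact: (Nz (k + n)%N (leq_trans mk (leq_addr _ _))).
have cD : countable (B `*` [set: nat]) by apply: countableX.
apply: meager_sub (meagerU (nowhere_dense_meager (nowhere_dense_dense_open
  (open_entering_minimal contf) dense_entering_minimal))
  (meager_bigcup_countable cD Nnd)).
move=> x ngx.
have [[M [n [minM Mx]]]|] := pselect (entering_minimal f x); last by left.
right.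
have oxM := minimal_trapping_omega minM (interior_subset Mx).
have [y [My noxy]] : exists y, M y /\ ~ omega_limit f x y.
  apply: contrapT => /forallNP H; apply: ngx; exists M => //.
  apply/seteqP; split=> // y My; apply: contrapT => nxy; exact: (H y).
have [V [yV [m Vm]]] : exists V, nbhs y V /\ exists m, forall n, (m <= n)%N -> ~ V (iter n f x).
  apply: contrapT => H; apply: noxy; apply/omega_limitP => V yV m.
  apply: contrapT => H2; apply: H; exists V; split=> //; exists m => k mk Vk.
  by apply: H2; exists k.
have [W [BW Wy] WV] := basisB y _ yV.
exists (W, m); first by [].
split; first by exists M, n; split=> //; exists y.
by move=> k mk /WV; exact: Vm.
Qed.

Section Minimal.
Variable M : set X.
Hypothesis minM : minimal_trapping f M.

Lemma interior_sub_basin : M° `<=` basin f M.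
Proof. by move=> x /interior_subset; exact: (minimal_trapping_omega minM (n:=0)). Qed.

Lemma minimal_trapping_compact : compact M.
Proof. by apply: (subclosed_compact (minimal_trapping_closed minM) cptX). Qed.

Lemma generic_basin x : generic x -> basin f M x -> omega_limit f x = M.
Proof.
move=> [N minN xN]; rewrite /basin /= xN => NM.
exact: minimal_trapping_sub minN minM NM.
Qed.

(** By Baire, the generic points of the interior of [M] form a nonmeager set. Their omega-limit set
    is all of [M], so they lie in the basin of [M] and in that of no proper subset. *)
Lemma minimal_trapping_attractor : topological_attractor f M.
Proof.
have M0 := minimal_trapping_interior minM.
have not_meager A : M° `&` generic `<=` A -> ~ meager A.
  move=> MA mA; apply: (compact_baire cptX (@open_interior _ M) M0).
  apply: meager_sub (meagerU mA meager_not_generic) => x Mx.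
  by have [gx|] := pselect (generic x); [left; exact: MA | right].
split.
- exact: minimal_trapping_compact.
- exact: minimal_trapping_image.
- by apply: not_meager => x [/interior_sub_basin].
move=> A cA fA [AM nMA].
apply: not_meager => x [/interior_sub_basin Mx /generic_basin/(_ Mx) xM].
by split=> //; rewrite /basin /= xM.
Qed.

Lemma generic_residual_basin :
  residual_in (basin f M) [set x | omega_limit f x = M].
Proof.
split; first by move=> x /= xM; rewrite /basin /= xM.
apply: meager_sub meager_not_generic => x [Mx nxM] gx.
exact/nxM/generic_basin.
Qed.

End Minimal.

(** Otherwise some nonwandering [z] outside all minimal sets is in the interior of one of them, [M],
    at a time [N]. Points near [z] stay in [M] from time [N] on, so they cannot return near [z]
    late; and [late_return] forbids early returns. *)
Lemma interior_nonwandering_minimal : interior (closure (nonwandering f `\`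
  \bigcup_(M in minimal_trapping f) M)) = set0.
Proof.
apply/nonemptyPn => U0.
have [x [Ux [M [N [minM Mx]]]]] := dense_entering_minimal U0 (@open_interior _ _).
pose A := \bigcup_(K in minimal_trapping f) K.
have oU : open ((closure (nonwandering f `\` A))° `&` iter N f @^-1` M°).
  apply: openI; first exact: open_interior.
  exact/(open_preimage_iter contf)/open_interior.
have [z [[nwz nAz] [Uz Mz]]] :=
  open_meets_closure oU (conj Ux Mx) (interior_subset Ux).
have stayM n y : (N <= n)%N -> M° (iter N f y) -> M (iter n f y).
  move=> Nn /interior_subset My; rewrite -(subnK Nn) iterD.
  exact: iter_invariant (minimal_trapping_invariant minM) My.
have cM := minimal_trapping_closed minM.
have nMz : ~ M z by move=> ?; apply: nAz; exists M.
have [|||V [oV Vz VU Vret]] := @late_return _ f contf hausX z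
    ((iter N f @^-1` M°) `&` ~` M) N.
- by apply: openI; [exact/(open_preimage_iter contf)/open_interior | exact: closed_openC].
- by [].
(* If [z] had period [n], it would equal its iterate at time [N * n], which is at least [N], and so
   lie in [M]. *)
- move=> n n0 nz; apply: nMz; rewrite -(iter_fixed nz N).
  by apply: stayM => //; exact: leq_pmulr.
have [n n1 [_ [[y Vy <-] Vny]]] := nwz V oV Vz.
have [nN|Nn] := ltnP n N; first by apply: (Vret n y) => //; rewrite n1.
have [_ nMny] := VU _ Vny; have [My _] := VU _ Vy.
exact/nMny/stayM.
Qed.

End Attractors.

(** * The strong core: strong transitivity and sensitivity *)

Section StrongCore.
Variables (R : realType) (X : metricType R) (f : X -> X) (d : R).
Hypotheses (cptX : compact [set: X]) (contf : continuous f).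
Hypotheses (openf : open_map f) (d_gt0 : 0 < d).
Hypothesis orbit_ball : forall U : set X, open U -> U !=set0 ->
  contains_ball d (forward_orbit f U).
Variable M : set X.
Hypothesis minM : minimal_trapping f M.

Let pieces : set (set X) := [set U | [/\ open U, U !=set0 & U `<=` M]].

Definition strong_core : set X :=
  \bigcap_(A in [set forward_orbit f U | U in pieces]) A.

Let pieces_orbit U : pieces U -> pieces (forward_orbit f U).
Proof.
move=> [oU U0 UM]; split; first exact: open_forward_orbit.
  exact: subset_nonempty (@sub_forward_orbit _ f U) U0.
exact: forward_orbit_subset (minimal_trapping_invariant minM) UM.
Qed.

Let pieces_interior : pieces M°.
Proof.
split; first exact: open_interior; first exact: minimal_trapping_interior minM.
exact: interior_subset.
Qed.

Lemma strong_core_ball : contains_ball d strong_core.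
Proof.
apply: contains_ball_bigcap => //.
- by exists (forward_orbit f M°), M°.
- move=> _ _ [U pU <-] [V pV <-].
  have [oU U0 UM] := pU; have [oV V0 VM] := pV.
  have [oOV _ _] := pieces_orbit pV.
  have [x [n [Ux _ Vx]]] : exists x n, [/\ U x, (0 <= n)%N & forward_orbit f V (iter n f x)].
    apply: (minimal_trapping_hits contf openf minM) => //.
    by have [y Vy] := V0; exists y; split; [exact: sub_forward_orbit | exact: VM].
  (* Directedness: [U] is moved forward until it meets the orbit of [V]; the orbit of the overlap
     lies in both orbits. *)
  have pW : pieces (iter n f @` U `&` forward_orbit f V).
    split; first by apply: openI => //; exact: open_image_iter.
      by exists (iter n f x); split=> //; exists x.
    by have [_ _ OVM] := pieces_orbit pV => y [_ /OVM].
  exists (forward_orbit f (iter n f @` U `&` forward_orbit f V)).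
    by exists (iter n f @` U `&` forward_orbit f V).
  apply: forward_orbit_subset.
    move=> _ [y [Uy Vy] <-].
    by split; apply: forward_orbit_invariant; exists y.
  move=> y [[z Uz zy] Vy]; split=> //; rewrite -zy.
  by exists n => //; exists z.
- by move=> _ [U [oU U0 _] <-]; exact: orbit_ball.
Qed.

Lemma strong_core_nonempty : strong_core !=set0.
Proof. by have [x xC] := strong_core_ball; exists x; apply: xC; exact: ballxx. Qed.

Lemma strong_core_invariant : forward_invariant f strong_core.
Proof.
move=> _ [x Cx <-] _ [U pU <-]; apply: forward_orbit_invariant.
by exists x => //; apply: Cx; exists U.
Qed.

Lemma strong_core_sub_orbit U : open U -> U !=set0 -> U `<=` M ->
  strong_core `<=` forward_orbit f U.
Proof. by move=> oU U0 UM x; apply; exists U. Qed.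

Lemma strong_core_sub : strong_core `<=` M°.
Proof.
have [oM M0 MM] := pieces_interior.
apply: subset_trans (strong_core_sub_orbit oM M0 MM) _.
apply: forward_orbit_subset => //.
exact: (interior_invariant openf (minimal_trapping_invariant minM)).
Qed.

(** The core contains a ball, so its interior is a nonempty open subset of [M] whose orbit contains
    the core. That interior is invariant, hence it contains its own orbit and so the whole core. *)
Lemma open_strong_core : open strong_core.
Proof.
have [x xC] := strong_core_ball.
have xin : ball x d `<=` strong_core°.
  exact: open_sub_interior (open_metric_ball _ _) xC.
rewrite openE; apply: (@subset_trans _ (forward_orbit f strong_core°)).
  apply: strong_core_sub_orbit; first exact: open_interior.
    by exists x; apply: xin; exact: ballxx.
  by move=> y /interior_subset/strong_core_sub/interior_subset.
apply: forward_orbit_subset => //.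
exact: (interior_invariant openf strong_core_invariant).
Qed.

Lemma strong_core_dense : closure strong_core = M.
Proof.
apply: (minimal_trapping_dense contf openf minM) => //.
- exact: open_strong_core.
- exact: strong_core_nonempty.
- by move=> x /strong_core_sub/interior_subset.
- exact: strong_core_invariant.
Qed.

(** For surjectivity, the image of the core is a nonempty open subset of [M], so its orbit covers
    the core; being invariant, it contains this orbit. *)
Lemma strong_core_image : f @` strong_core = strong_core.
Proof.
apply/seteqP; split; first exact: strong_core_invariant.
have fC := strong_core_invariant.
apply: (@subset_trans _ (forward_orbit f (f @` strong_core))).
  apply: strong_core_sub_orbit; first exact/openf/open_strong_core.
    exact/image_nonempty/strong_core_nonempty.
  by move=> x /fC/strong_core_sub/interior_subset.
by apply: forward_orbit_subset => // _ [x /fC Cx <-]; exists x.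
Qed.

Lemma strong_core_strongly_transitive : strongly_transitive_on f strong_core.
Proof.
move=> _ [V oV ->] CV0; apply/seteqP; split.
  by apply: forward_orbit_subset => [|x []//]; exact: strong_core_invariant.
apply: strong_core_sub_orbit => //.
  by apply: openI => //; exact: open_strong_core.
by move=> x [/strong_core_sub/interior_subset].
Qed.

Lemma diameter_ge (A : set X) x y : A x -> A y ->
  ((mdist x y)%:E <= diameter A)%E.
Proof. by move=> Ax Ay; apply: ereal_sup_ubound; exists (x, y). Qed.

Lemma strong_core_sensitive x0 : strong_core x0 -> omega_limit f x0 <> M ->
  sensitive_dependence f M.
Proof.
move=> Cx0 nx0M.
have x0M : omega_limit f x0 `<=` M.
  apply: (minimal_trapping_omega minM (n := 0)).
  exact: (interior_subset (strong_core_sub Cx0)).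
have [y [My nx0y]] : exists y, M y /\ ~ omega_limit f x0 y.
  apply: contrapT => /forallNP H; apply: nx0M.
  by apply/seteqP; split=> // y My; apply: contrapT => nxy; exact: (H y).
have [r r0 [m Vm]] : exists2 r : R, 0 < r & exists m, forall n, (m <= n)%N ->
    ~ ball y r (iter n f x0).
  apply: contrapT => H; apply: nx0y; apply/omega_limitP => V /nbhs_ballP[r r0 rV] m.
  apply: contrapT => H2; apply: H; exists r => //; exists m => k mk Vk.
  by apply: H2; exists k => //; exact: rV.
exists (r / 2); first exact: divr_gt0.
move=> x e Mx e0.
pose U := ball x e `&` M°.
have oU : open U by apply: openI; [exact: open_metric_ball | exact: open_interior].
have U0 : U !=set0.
  apply: (minimal_trapping_meets_interior contf openf minM _ _ Mx).
    exact: open_metric_ball.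
  exact: ballxx.
have UM : U `<=` M by move=> z [_ /interior_subset].
have UB : U `<=` M `&` ball x e by move=> z [? /interior_subset].
(* The point [u] reaches [x0] at time [k], so from time [k + m] on its orbit is outside [ball y r],
   while [v] visits [ball y (r / 2)] at some such time. There the two orbits are at least [r / 2]
   apart. *)
have [k _ [u Uu ux0]] := strong_core_sub_orbit oU U0 UM Cx0.
have [|v [n [Uv kmn yv]]] := minimal_trapping_hits contf openf minM (k + m) oU U0 UM
    (open_metric_ball y (r / 2)).
  by exists y; split=> //; apply: ballxx; exact: divr_gt0.
apply: le_trans (ereal_sup_ubound _); last by exists n.
apply: (@le_trans _ _ (mdist (iter n f v) (iter n f u))%:E); last first.
  by apply: diameter_ge; [exists v | exists u] => //; exact: UB.
rewrite lee_fin leNgt; apply/negP => vu.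
have km : (k <= n)%N := leq_trans (leq_addr _ _) kmn.
apply: (Vm (n - k)%N); first by rewrite leq_subRL.
rewrite -ux0 -iterD subnK // (splitr r); apply: ball_triangle yv _.
by rewrite ballEmdist.
Qed.

End StrongCore.

(** * The attractors and their properties, assembled *)

Theorem theoremA (R : realType) (X : metricType R) (f : X -> X) (d : R)
  (cptX : compact [set: X])
  (contf : continuous f)
  (openf : open_map f)
  (d_gt0 : 0 < d)
  (orbit_ball : forall U : set X, open U -> U !=set0 ->
     contains_ball d (closure (forward_orbit f U))) :
  exists (l : nat) (A : 'I_l -> set X),
    (forall j, topological_attractor f (A j)) /\
    (* 1 *)
    (exists W : set X,
       [/\ open W, dense W & W `<=` \bigcup_j basin f (A j)]) /\
    (* 2 *)
    (forall j, contains_ball d (A j) /\ A j = closure (interior (A j))) /\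
    (* 3 *)
    (forall j, transitive_on f (A j) /\
       exists2 G : set X, residual_in (basin f (A j)) G &
         forall x, G x -> omega_limit f x = A j) /\
    (* 4 *)
    (compact (closure (nonwandering f `\` \bigcup_j A j)) /\
     interior (closure (nonwandering f `\` \bigcup_j A j)) = set0) /\
    ((forall U : set X, open U -> U !=set0 ->
        contains_ball d (forward_orbit f U)) ->
     forall j, exists B : set X,
       B `<=` A j /\
       (* 5 *)
       ((exists W : set X,
           [/\ relatively_open (A j) W, A j `<=` closure W & W `<=` B]) /\
        f @` B = B /\
        strongly_transitive_on f B) /\
       (* 6 *)
       ((forall x, B x -> omega_limit f x = A j) \/
        sensitive_dependence f (A j))).
Proof.
(* The [A j] exhaust the minimal trapping sets, possibly with repetitions. *)
have [l [A [minA allA]]] := minimal_trapping_finite cptX contf openf d_gt0 orbit_ball.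
have AE : \bigcup_j A j = \bigcup_(M in minimal_trapping f) M.
  apply/seteqP; split=> x [].
    by move=> j _ Ax; exists (A j).
  by move=> M /allA[j ->] Ax; exists j.
exists l, A; split; first by move=> j; exact: (minimal_trapping_attractor _ _ _ d_gt0).
split.
  exists (entering_minimal f); split.
  - exact: open_entering_minimal.
  - exact: (dense_entering_minimal _ _ _ d_gt0).
  - move=> x [M [n [minM /interior_subset Mx]]]; have [j jM] := allA _ minM.
    by exists j => //; rewrite -jM; exact: (minimal_trapping_omega minM Mx).
split.
  move=> j; split; first by apply: (trapping_ball orbit_ball); case: (minA j).
  by rewrite (minimal_trapping_regular contf openf (minA j)).
split.
  move=> j; split.
    apply: minimal_trapping_transitive => //.
    by apply: minimal_trapping_image => //; exact: metric_hausdorff.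
  exists [set x | omega_limit f x = A j] => //.
  exact: (generic_residual_basin _ _ _ d_gt0).
split.
  rewrite AE; split; last exact: (interior_nonwandering_minimal _ _ _ d_gt0).
  by apply: (subclosed_compact _ cptX) => //; exact: closed_closure.
move=> strong j; have minM := minA j.
exists (strong_core f (A j)); split.
  by move=> x /(strong_core_sub openf minM)/interior_subset.
split.
  split; last split.
  - exists (strong_core f (A j)); split=> //.
      exists (strong_core f (A j)); first exact: open_strong_core d_gt0 _ _ _.
      by apply/esym/setIidPr => x /(strong_core_sub openf minM)/interior_subset.
    by rewrite (strong_core_dense cptX contf openf d_gt0 strong minM).
  - exact: (strong_core_image cptX contf openf d_gt0 strong minM).
  - exact: (strong_core_strongly_transitive cptX contf openf d_gt0 strong minM).
have [|/existsNP[x /not_implyP[Cx nxA]]] :=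
  pselect (forall x, strong_core f (A j) x -> omega_limit f x = A j); first by left.
by right; exact: (strong_core_sensitive contf openf minM Cx nxA).
Qed.
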